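(* Let $k\ge 2$ and let $\alpha,\beta,\gamma,\delta\in\mathbb{C}$ be such that $q:=1+\beta\gamma-\alpha\delta\neq0$, $[r]\neq 0$ for $1\le r\le k$, and $1+\beta\gamma[n]\neq0$ for every positive integer $n$, where $[n]=(1-q^n)/(1-q)$. Suppose $(\alpha+\beta)(\gamma+\delta)=0$. Then, with $H$ the discrete Hamiltonian and $F(L)^W$ identified with $F(L_+)$ by restriction, $$(H-k)|_{F(L_+)}=\begin{cases}\mathcal{H}(q^{-1}\alpha\delta,\,q^{-1}) & \text{if }\alpha+\beta=0,\\ \mathcal{H}(\beta\gamma,\,q) & \text{if }\gamma+\delta=0.\end{cases}$$
   Context: $V=\bigoplus_{i=1}^k\mathbb{R}v_i$ is Euclidean space with orthonormal basis $\{v_i\}$; $\{\epsilon_i\}$ is the dual basis; $\alpha_{ij}=\epsilon_i-\epsilon_j$. $L=\bigoplus_{i=1}^k\mathbb{Z}v_i$; $F(L)$ is the space of functions $L\to\mathbb{C}$; $F(L)^W$ is the subspace of functions invariant under permutations of the coordinates ($W\cong\mathfrak{S}_k$). $L_+=\{x\in L\mid\epsilon_1(x)\ge\cdots\ge\epsilon_k(x)\}$, and $F(L_+)$, the space of functions on $L_+$, is identified with $F(L)^W$ by restriction. The operator $H$ below maps $F(L)^W$ to itself, so it restricts to $F(L_+)$. Discrete Hamiltonian. $[n]=1+q+\cdots+q^{n-1}$ ($[0]=0$), $[n]!=\prod_{a=1}^n[a]$, $[0]!=1$; $(\widehat{X}_if)(x)=f(x-v_i)$. For $x\in L$, $d_i^+(x)=\#\{p\mid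 i<p\le k,\ \alpha_{ip}(x)=0\}$, $d_i^-(x)=\#\{p\mid 1\le p<i,\ \alpha_{pi}(x)=0\}$, and $\delta_{j_1,\dots,j_r}(x)=1$ if $\epsilon_{j_1}(x)=\cdots=\epsilon_{j_r}(x)$ and $0$ otherwise ($\delta_j\equiv 1$). Then $$H=-\alpha\gamma\sum_{j=1}^k\frac{[d_j^+]}{1+\beta\gamma[d_j^+]}+\sum_{r=1}^k(-\beta\delta)^{r-1}[r-1]!\,q^{-r(r-1)/2}\sum_{1\le j_1<\cdots<j_r\le k}\frac{q^{\sum_{p=1}^rd_{j_p}^-}\,\delta_{j_1,\dots,j_r}}{\prod_{p=0}^{r-1}(1+\beta\gamma[d_{j_1}^++d_{j_1}^--p])}\prod_{p=1}^r\widehat{X}_{j_p},$$ where functions on $L$ act by multiplication (after the shifts are applied), and terms at points where $\delta_{j_1,\dots,j_r}(x)=0$ are $0$. Cluster coordinate. For $x\in L_+$, its cluster coordinate is the tuple $(c_1,\dots,c_M)$ of positive integers with $\sum_{i=1}^M c_i=k$, $\epsilon_{c_1}(x)>\epsilon_{c_1+c_2}(x)>\cdots>\epsilon_{c_1+\cdots+c_M}(x)$, and $\epsilon_j(x)=\epsilon_{c_1+\cdots+c_i}(x)$ whenever $c_1+\cdots+c_{i-1}<j\le c_1+\cdots+c_i$. For parameters $s,t$, the operator $\mathcal{H}(s,t)$ on $F(L_+)$ is $$(\mathcal{H}(s,t)f)(x)=\sum_{i=1}^M\sum_{r=1}^{c_i}\frac{s^{r-1}}{[r]_t}\prod_{p=0}^{r-1}\frac{[c_i-p]_t}{1+s[c_i-1-p]_t}\Bigl(f\bigl(x-\sum_{p=0}^{r-1}v_{c_1+\cdots+c_i-p}\bigr)-f(x)\Bigr),$$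 where $(c_1,\dots,c_M)$ is the cluster coordinate of $x$ and $[n]_t=1+t+\cdots+t^{n-1}$. (So in $\mathcal{H}(q^{-1}\alpha\delta,q^{-1})$ the $q$-integers are taken with base $q^{-1}$.) *)

(* Defs.v *)
From HB Require Import structures.
From mathcomp Require Import all_boot all_order all_fingroup all_algebra.
From mathcomp Require Import zify.
From mathcomp Require Import reals complex.

Set Implicit Arguments.
Unset Strict Implicit.
Unset Printing Implicit Defensive.

Import Order.TTheory GRing.Theory Num.Theory.
Local Open Scope ring_scope.

(* L = Z^k is 'rV[int]_k.  Coordinates are numbered from 0, so that
   epsilon_j and v_j are indexed here by j - 1. *)

Section Lattice.
Variable k : nat.
Implicit Types (x : 'rV[int]_k) (c : seq nat).

(* A nat-indexed basis vector; it is 0 when j >= k. *)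
Definition basis_vec (j : nat) : 'rV[int]_k := \row_(i < k) (i == j :> nat)%:R.

(* A nat-indexed coordinate; it is 0 when j >= k. *)
Definition eps (j : nat) x : int := nth 0 [seq x 0 i | i <- enum 'I_k] j.

Definition dominant x : bool :=
  [forall i : 'I_k, forall j : 'I_k, (i <= j)%N ==> (x 0 j <= x 0 i)].

Definition Lplus : Type := {x : 'rV[int]_k | dominant x}.

Definition W_invariant (T : Type) (f : 'rV[int]_k -> T) : Prop :=
  forall (w : 'S_k) x, f (col_perm w x) = f x.

Definition restr (T : Type) (f : 'rV[int]_k -> T) (y : Lplus) : T := f (val y).

Definition dplus (i : 'I_k) x : nat :=
  #|[set p : 'I_k | (i < p)%N && (x 0 i - x 0 p == 0)]|.

Definition dminus (i : 'I_k) x : nat :=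
  #|[set p : 'I_k | (p < i)%N && (x 0 p - x 0 i == 0)]|.

(* partial_sum c i = c_1 + ... + c_i; the i-th block (counted from 0) occupies
   the coordinates j with partial_sum c i <= j < partial_sum c i.+1. *)
Definition partial_sum c (i : nat) : nat := sumn (take i c).

Definition is_cluster_coord x c : bool :=
  [&& all (leq 1) c,
      sumn c == k,
      [forall i : 'I_(size c),
         (i.+1 < size c)%N ==>
           (eps (partial_sum c i.+2).-1 x < eps (partial_sum c i.+1).-1 x)] &
      [forall i : 'I_(size c), forall j : 'I_k,
         (partial_sum c i <= j < partial_sum c i.+1)%N ==>
           (eps j x == eps (partial_sum c i.+1).-1 x)]].

Lemma eps_ord (i : 'I_k) x : eps i x = x 0 i.
Proof. by rewrite /eps (nth_map i) ?size_enum_ord // nth_ord_enum. Qed.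

Lemma dominant_eps x : dominant x ->
  forall i j, (i <= j)%N -> (j < k)%N -> eps j x <= eps i x.
Proof.
move=> /forallP dx i j ij jk; have ik := leq_ltn_trans ij jk.
have /forallP/(_ (Ordinal jk))/implyP := dx (Ordinal ik).
by rewrite -!eps_ord /=; apply.
Qed.

Lemma partial_sumS c i : partial_sum c i.+1 = (partial_sum c i + nth 0%N c i)%N.
Proof.
rewrite /partial_sum; have [ic|ci] := ltnP i (size c).
  by rewrite (take_nth 0%N ic) sumn_rcons.
by rewrite !take_oversize ?nth_default ?addn0 //; lia.
Qed.

Lemma partial_sum_le c i : (partial_sum c i <= sumn c)%N.
Proof. by rewrite -{2}(cat_take_drop i c) sumn_cat leq_addr. Qed.

Lemma partial_sum_rcons c m i : (i <= size c)%N ->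
  partial_sum (rcons c m) i = partial_sum c i.
Proof. by move=> ic; rewrite /partial_sum -cats1 takel_cat. Qed.

Lemma partial_sum_size c i : (size c <= i)%N -> partial_sum c i = sumn c.
Proof. by move=> ci; rewrite /partial_sum take_oversize. Qed.

Lemma cluster_coord_exists (y : Lplus) : exists c, is_cluster_coord (val y) c.
Proof.
case: y => x /= /dominant_eps dx.
suff: forall n, (n <= k)%N -> exists c, [/\ all (leq 1) c, sumn c = n,
    forall i, (i.+1 < size c)%N ->
      eps (partial_sum c i.+2).-1 x < eps (partial_sum c i.+1).-1 x
  & forall i j, (i < size c)%N ->
      (partial_sum c i <= j < partial_sum c i.+1)%N ->
      eps j x = eps (partial_sum c i.+1).-1 x].
  case/(_ k (leqnn k)) => c [cp cs cd cc]; exists c; apply/and4P; split=> //.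
  - exact/eqP.
  - by apply/forallP=> i; apply/implyP=> /cd.
  - apply/forallP=> i; apply/forallP=> j; apply/implyP=> ij.
    by apply/eqP/cc.
elim=> [|n IHn] nk; first by exists [::]; split=> // -[].
have [c [cp cs cd cc]] := IHn (ltnW nk).
case: (lastP c) cp cs cd cc => [|c' m] cp cs cd cc.
  exists [:: 1%N]; move: cs => /= <-; split=> //= -[|i] j //= _.
  by rewrite /partial_sum /=; case: j.
move: cp cs; rewrite all_rcons sumn_rcons => /andP[mp cp] cs.
have n0 : (0 < n)%N by lia.
have SE d i : (i < (size c').+1)%N ->
    partial_sum (rcons c' d) i = partial_sum c' i.
  by move=> ic; rewrite partial_sum_rcons.
have SL d : partial_sum (rcons c' d) (size c').+1 = (sumn c' + d)%N.
  by rewrite partial_sum_size ?size_rcons // sumn_rcons.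
rewrite size_rcons in cd cc.
case: (eqVneq (eps n x) (eps n.-1 x)) => [enn|nenn].
  exists (rcons c' m.+1); split; rewrite ?all_rcons ?cp ?sumn_rcons ?size_rcons //.
  - lia.
  - move=> i ic; move: (cd i ic); rewrite (SE _ i.+1) // (SE _ i.+1) //.
    have [ilt|ige] := ltnP i.+1 (size c'); first by rewrite !SE //; lia.
    have -> : i.+2 = (size c').+1 by lia.
    rewrite !SL cs; have -> : (sumn c' + m.+1).-1 = n by lia.
    by rewrite enn.
  - move=> i j ic; rewrite (SE _ i) //.
    have [ilt|ige] := ltnP i (size c').
      by rewrite SE //; have := cc i j ic; rewrite !SE.
    have ei : i = size c' by lia.
    subst i; rewrite SL partial_sum_size // => /andP[j1 j2].
    have -> : (sumn c' + m.+1).-1 = n by lia.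
    have [jn|jn] := eqVneq j n; first by rewrite jn.
    have := cc (size c') j (ltnSn _); rewrite SL SE // partial_sum_size // cs enn.
    by apply; lia.
exists (rcons (rcons c' m) 1%N).
have SE2 i : (i < (size c').+2)%N ->
    partial_sum (rcons (rcons c' m) 1%N) i = partial_sum (rcons c' m) i.
  by move=> ic; rewrite partial_sum_rcons // size_rcons.
have SL2 : partial_sum (rcons (rcons c' m) 1%N) (size c').+2 = n.+1.
  by rewrite partial_sum_size ?size_rcons // !sumn_rcons; lia.
split; rewrite ?all_rcons ?cp ?mp ?sumn_rcons ?size_rcons //.
- lia.
- move=> i ic; rewrite (SE2 i.+1) //.
  have [ilt|ige] := ltnP i.+1 (size c').+1; first by rewrite SE2 ?cd.
  have ei : i = size c' by lia.
  subst i; rewrite SL2 SL cs /= lt_neqAle nenn /=; apply: dx => //; lia.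
- move=> i j ic; have [ilt|ige] := ltnP i (size c').+1.
    by rewrite !SE2 //; apply: cc.
  have -> : i = (size c').+1 by lia.
  rewrite SL2 SE2 // SL cs /= => ij; congr (eps _ x); lia.
Qed.

Definition cluster_coord (y : Lplus) : seq nat :=
  xchoose (cluster_coord_exists y).

(* The point x - sum_(p = 0)^r v_(c_1 + ... + c_(i+1) - p), for 0 <= r < c_(i+1). *)
Definition lower_vec x c (i r : nat) : 'rV[int]_k :=
  x - \sum_(p < r.+1) basis_vec (partial_sum c i.+1 - p.+1).

Lemma lower_vec_dominant (y : Lplus) (i : 'I_(size (cluster_coord y)))
    (r : 'I_(nth 0%N (cluster_coord y) i)) :
  dominant (lower_vec (val y) (cluster_coord y) i r).
Proof.
move: r; set c := cluster_coord y => r; have rc := ltn_ord r.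
have /and4P[cp /eqP ck /forallP cd /forallP cc] : is_cluster_coord (val y) c.
  exact: xchooseP.
have dx := dominant_eps (valP y).
have ES : partial_sum c i.+1 = (partial_sum c i + nth 0%N c i)%N.
  exact: partial_sumS.
have Ek : (partial_sum c i.+1 <= k)%N by rewrite -[X in (_ <= X)%N]ck partial_sum_le.
set e := partial_sum c i.+1 in ES Ek *.
have re : (r < e)%N by rewrite ES (leq_trans rc) // leq_addl.
have rs : (partial_sum c i <= e - r.+1)%N by rewrite leq_subRL // ES addnC leq_add2l.
have S1 (l : 'I_k) : (\sum_(p < r.+1) basis_vec (e - p.+1)) 0 l
    = ((e - r.+1 <= l < e)%N : nat)%:Z.
  rewrite summxE; under eq_bigr do rewrite mxE.
  have [/andP[l1 l2]|nl] := boolP (_ <= l < _)%N.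
    have lr : (e - l.+1 < r.+1)%N by lia.
    rewrite (bigD1 (Ordinal lr)) //= big1 ?addr0 => [|p np].
      by have -> : (l == e - (e - l.+1).+1 :> nat)%N by lia.
    have /negbTE-> // : (l != e - p.+1 :> nat)%N.
    by apply: contraNneq np => lp; apply/eqP/val_inj => /=; have := ltn_ord p; lia.
  rewrite big1 // => p _; have /negbTE-> // : (l != e - p.+1 :> nat)%N.
  by apply: contraNneq nl => lp; have := ltn_ord p; lia.
apply/forallP=> a; apply/forallP=> b; apply/implyP=> ab.
rewrite mxE [in leRHS]mxE !mxE !S1 -!eps_ord.
have ba := dx a b ab (ltn_ord b).
have [/andP[a1 a2]|na] := boolP (_ <= a < _)%N; last by case: (_ <= b < _)%N; lia.
have [/andP[b1 b2]|nb] := boolP (_ <= b < _)%N; first by lia.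
have be : (e <= b)%N by lia.
suff: eps b (val y) < eps a (val y) by lia.
have isz : (i.+1 < size c)%N.
  rewrite ltnNge; apply/negP=> szi; move: be; rewrite /e partial_sum_size // ck.
  by have := ltn_ord b; lia.
have /implyP/(_ isz) lt1 := cd i.
have ea : eps a (val y) = eps e.-1 (val y).
  have /forallP/(_ a)/implyP := cc i; rewrite -/e => H; apply/eqP/H.
  by rewrite a2 andbT (leq_trans rs).
apply: le_lt_trans (_ : eps e (val y) < _); first exact: dx.
have e2 : (e < partial_sum c i.+2)%N.
  rewrite partial_sumS -/e; have /allP/(_ (nth 0%N c i.+1)) := cp.
  by rewrite mem_nth // => /(_ isT); lia.
have ek : (e < k)%N by apply: leq_ltn_trans (ltn_ord b).
have /forallP/(_ (Ordinal ek))/implyP := cc (Ordinal isz).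
by rewrite /= partial_sumS -/e -partial_sumS leqnn e2 => /(_ isT)/eqP->; rewrite ea.
Qed.

Definition lower (y : Lplus) (i : 'I_(size (cluster_coord y)))
    (r : 'I_(nth 0%N (cluster_coord y) i)) : Lplus :=
  exist (fun x => dominant x) _ (lower_vec_dominant r).

End Lattice.

Section Operators.
Variables (k : nat) (F : fieldType).

Definition qint (q : F) (n : nat) : F := \sum_(a < n) q ^+ a.

Definition qfact (q : F) (n : nat) : F := \prod_(1 <= a < n.+1) qint q a.

Definition shift_op (i : 'I_k) (f : 'rV[int]_k -> F) : 'rV[int]_k -> F :=
  fun x => f (x - basis_vec k i).

Definition delta_coord (js : seq 'I_k) (x : 'rV[int]_k) : F :=
  [forall i : 'I_k, forall j : 'I_k,
     (i \in js) && (j \in js) ==> (x 0 i == x 0 j)]%:R.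

Definition q_param (al be ga de : F) : F := 1 + be * ga - al * de.

(* The index r < k stands for the number r + 1 of shifted coordinates, which
   are listed by the increasing tuple js, with thead js = j_1.  When
   delta_coord js x = 1, the natural subtraction in the product is exact;
   otherwise the summand vanishes. *)
Definition hamiltonian (al be ga de : F) (f : 'rV[int]_k -> F)
    (x : 'rV[int]_k) : F :=
  let q := q_param al be ga de in
  - (al * ga)
    * (\sum_(j < k) qint q (dplus j x) / (1 + be * ga * qint q (dplus j x)))
    * f x
  + \sum_(r < k)
      (- (be * de)) ^+ r * qfact q r * q ^- ((r.+1 * r) %/ 2)
      * \sum_(js : r.+1.-tuple 'I_k | sorted ltn (map val js))
          q ^+ (\sum_(p < r.+1) dminus (tnth js p) x) * delta_coord js x
          / (\prod_(p < r.+1)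
               (1 + be * ga *
                  qint q (dplus (thead js) x + dminus (thead js) x - p)))
          * foldr shift_op f js x.

(* Here again r stands for the number r + 1 of lowered coordinates.  Functions
   on L_+ are functions on the subtype Lplus, and lower r is the point
   lower_vec of the block i, which lies in L_+ by lower_vec_dominant. *)
Definition cluster_op (s t : F) (g : Lplus k -> F) (y : Lplus k) : F :=
  let c := cluster_coord y in
  \sum_(i < size c) \sum_(r < nth 0%N c i)
    s ^+ r / qint t r.+1
    * (\prod_(p < r.+1)
         (qint t (nth 0%N c i - p) / (1 + s * qint t (nth 0%N c i - 1 - p))))
    * (g (lower r) - g y).

End Operators.

(* Main.v *)
(** On a cluster of size [n] the hops of [r] particles contribute the elementary
    symmetric function of [1, q, ..., q^(n-1)], a Gaussian binomial coefficient
    read off from the product of the [1 + q^m X].  By permutation invariance all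
    these hops lead to the same value of [f], so [H] acts cluster by cluster,
    and the condition [gamma + delta = 0] (or [alpha + beta = 0], after
    replacing [q] by [q^-1]) turns its off-diagonal coefficients into those of
    the cluster operator.  The diagonal parts agree because
    [sum_r s^(r-1)/[r] prod_(p < r) [n-p]/(1+s[n-1-p]) = sum_(m < n) t^m/(1+s[m])],
    a telescoping identity. *)

Require Import Defs.
From mathcomp Require Import all_boot all_order all_fingroup all_algebra.
From mathcomp Require Import zify ring.
From mathcomp Require Import reals complex.

Import Order.TTheory GRing.Theory Num.Theory.
Local Open Scope ring_scope.

(** * Gaussian integers, binomials and the telescoping sum of hop weights *)

Section QIntegers.
Set Implicit Arguments.
Unset Strict Implicit.
Context {F : fieldType}.
Implicit Types (q s t : F) (m n r c : nat).

Lemma qint0 q : qint q 0 = 0.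
Proof. exact: big_ord0. Qed.

Lemma qint1 q : qint q 1 = 1.
Proof. exact: big_ord1. Qed.

Lemma qintD q m n : qint q (m + n) = qint q m + q ^+ m * qint q n.
Proof.
rewrite /qint big_split_ord mulr_sumr; congr (_ + _).
by apply: eq_bigr => a _; rewrite exprD.
Qed.

Lemma qintS q n : qint q n.+1 = 1 + q * qint q n.
Proof. by rewrite -add1n qintD qint1. Qed.

Lemma expr_qint q n : q ^+ n = 1 + (q - 1) * qint q n.
Proof. by rewrite /qint -subrX1; ring. Qed.

(** Reversal of the order of summation. *)
Lemma qintV q n : q != 0 -> qint q^-1 n.+1 = q ^- n * qint q n.+1.
Proof.
move=> q0; rewrite /qint mulr_sumr (reindex_inj rev_ord_inj) /=.
apply: eq_bigr => a _; rewrite subSS exprVn; have := ltn_ord a; rewrite ltnS => an.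
by rewrite expfB_cond ?(negPf q0) // invf_div mulrC.
Qed.

Lemma qfactS q n : qfact q n.+1 = qfact q n * qint q n.+1.
Proof. by rewrite /qfact big_nat_recr. Qed.

Lemma qint_prod_small q c n : (c < n)%N -> \prod_(p < n) qint q (c - p) = 0.
Proof.
by move=> cn; rewrite (bigD1 (Ordinal cn)) //= subnn qint0 mul0r.
Qed.

(* The coefficient is q^(n(n-1)/2) times a Gaussian binomial; the product
   vanishes for c < n because one of its factors is then [0]. *)
Lemma qbinomial_coef q c n :
  (\prod_(m < c) (1 + (q ^+ m)%:P * 'X) : {poly F})`_n * qfact q n
    = q ^+ ((n * n.-1) %/ 2) * \prod_(p < n) qint q (c - p).
Proof.
elim: c n => [|c IHc] [|n].
- by rewrite !big_ord0 /qfact big_geq // coef1 /= expr0.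
- by rewrite big_ord0 coef1 qint_prod_small // mul0r mulr0.
- rewrite big_ord_recr /= mulrDr mulr1 mulrA coefD coefMX /= addr0.
  by rewrite IHc !big_ord0.
rewrite big_ord_recr /= mulrDr mulr1 mulrA coefD coefMX /= coefMC mulrDl IHc.
rewrite qfactS [_ * q ^+ c * _]mulrACA IHc /=.
have -> : ((n.+1 * n) %/ 2 = (n * n.-1) %/ 2 + n)%N.
  case: (n) => [|n'] //=; have -> : (n'.+2 * n'.+1 = n'.+1 * 2 + n'.+1 * n')%N by lia.
  by rewrite divnMDl // addnC.
rewrite exprD big_ord_recr big_ord_recl /= subn0.
under [in RHS]eq_bigr do rewrite /bump /= add1n subSS.
have [nc|cn] := leqP n c; last by rewrite qint_prod_small // !(mul0r, mulr0) addr0.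
(* Pascal's rule: this splitting of [[c+1]] matches the two terms obtained by expanding the last
   factor [1 + q^c X]. *)
have -> : qint q c.+1 = qint q (c - n) + q ^+ (c - n) * qint q n.+1.
  by rewrite -qintD; congr qint; lia.
have {1}-> : q ^+ c = q ^+ (c - n) * q ^+ n by rewrite -exprD subnK.
ring.
Qed.

(** The weight in [cluster_op s t] of the hop of [r.+1] particles out of a cluster of size [n]. *)
Definition cluster_coef s t n r : F :=
  s ^+ r / qint t r.+1
    * \prod_(p < r.+1) (qint t (n - p) / (1 + s * qint t (n - 1 - p))).

(* The increment in n of the r-th summand is U r - U r.+1, so the sum over r
   telescopes to U 0. *)
Lemma sum_cluster_coef s t n :
    (forall r, (0 < r <= n)%N -> qint t r != 0) ->
    (forall m, (m < n)%N -> 1 + s * qint t m != 0) ->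
  \sum_(r < n) cluster_coef s t n r
    = \sum_(m < n) t ^+ m / (1 + s * qint t m).
Proof.
elim: n => [|n IHn] t0 s0; first by rewrite !big_ord0.
have w0 m : (m <= n)%N -> 1 + s * qint t m != 0 by apply: s0.
have TE r : cluster_coef s t n.+1 r = s ^+ r / qint t r.+1 * qint t n.+1 *
    \prod_(p < r) qint t (n - p) / \prod_(p < r.+1) (1 + s * qint t (n - p)).
  rewrite /cluster_coef prodf_div (big_ord_recl r (fun p => qint t (n.+1 - p))) /= subn0.
  under eq_bigr do rewrite /bump /= add1n subSS.
  by rewrite subn1 /= !mulrA.
pose U r := s ^+ r * t ^+ (n - r) * \prod_(p < r) qint t (n - p)
  / \prod_(p < r.+1) (1 + s * qint t (n - p)).
have step r : (r < n)%N ->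
    cluster_coef s t n.+1 r = cluster_coef s t n r + (U r - U r.+1).
  move=> rn; rewrite TE /cluster_coef /U prodf_div.
  have b0 : qint t r.+1 != 0 by apply: t0; lia.
  have wr0 : 1 + s * qint t (n - r.+1) != 0 by apply: w0; lia.
  have wn0 : 1 + s * qint t n != 0 by apply: w0.
  set W := \prod_(p < r.+1) (1 + s * qint t (n - p)).
  have W0 : W != 0 by apply/prodf_neq0 => p _; apply: w0; lia.
  (* Lowering [n] by one drops the first factor of [W] and gains a new last one. *)
  have -> : \prod_(p < r.+1) (1 + s * qint t (n - 1 - p))
      = W * (1 + s * qint t (n - r.+1)) / (1 + s * qint t n).
    rewrite /W -(big_ord_recr r.+1 (fun p => 1 + s * qint t (n - p))) /=.
    rewrite [in RHS]big_ord_recl /= subn0 [RHS]mulrC mulKf //.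
    by apply: eq_bigr => p _; rewrite /bump /= -subnDA.
  rewrite (big_ord_recr r (fun p => qint t (n - p))).
  rewrite (big_ord_recr r.+1 (fun p => 1 + s * qint t (n - p))) -/W /=.
  move: W0 wr0 wn0; move: {W}(W) => W W0.
  (* With [n = r + 1 + d], all q-integers and powers of [t] reduce to [[d]] and [[r+1]], and the
     claim becomes an identity of rational functions. The nonvanishing conditions stay in the goal
     to be rewritten along with it. *)
  set P := \prod_(_ < r) _; have [d nE] : exists d, n = (r.+1 + d)%N.
    by exists (n - r.+1)%N; lia.
  have -> : (n - r.+1 = d)%N by lia.
  have -> : (n - r = d.+1)%N by lia.
  have -> : qint t n.+1 = qint t d.+1 + t ^+ d.+1 * qint t r.+1.
    by rewrite -qintD; congr qint; lia.
  have -> : qint t n = qint t d + t ^+ d * qint t r.+1.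
    by rewrite -qintD; congr qint; lia.
  rewrite (qintS t d) !exprS (expr_qint t d) => wr0 wn0.
  by field; rewrite W0 wr0 wn0 b0.
have UE : cluster_coef s t n.+1 n = U n.
  rewrite TE /U subnn expr0 mulr1 mulfVK // t0 //; lia.
rewrite big_ord_recr /= UE.
under eq_bigr => r _ do rewrite step //.
rewrite big_split /= IHn => [|r rn|m mn]; [|apply: t0; lia|apply: w0; lia].
rewrite [RHS]big_ord_recr /= -addrA; congr (_ + _).
(* The extra summand [r = n] cancels [- U n], and [U 0] is the new term [m = n] on the right. *)
have -> : \sum_(r < n) (U r - U r.+1) = U 0%N - U n.
  rewrite -(big_mkord xpredT (fun r => U r - U r.+1)).
  by rewrite -[RHS]opprB -(telescope_sumr U) // -sumrN; apply: eq_bigr => r _; rewrite opprB.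
by rewrite subrK /U subn0 big_ord0 big_ord1 subn0 mul1r mulr1.
Qed.

End QIntegers.

(** * From increasing tuples to subsets and elementary symmetric functions *)

Section SortedTuples.
Set Implicit Arguments.
Unset Strict Implicit.

Lemma big_ord_interval (T : Type) (idx : T) (op : Monoid.com_law idx) k a b
    (F : nat -> T) : (b <= k)%N ->
  \big[op/idx]_(j < k | (a <= j < b)%N) F j = \big[op/idx]_(m < b - a) F (a + m)%N.
Proof.
move=> bk; rewrite -(big_mkord (fun j => a <= j < b)%N).
rewrite -(big_nat_widen 0 b k (fun j => a <= j)%N) //.
rewrite -(big_nat_widenl a 0 b predT) // -{1}[a]add0n big_addn big_mkord.
by apply: eq_bigr => m _; rewrite addnC.
Qed.

(** An increasing tuple is determined by its set of entries, and every subset of size [n] arises by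
    enumerating it in order. *)
Lemma sum_sorted_tuples (V : nmodType) k n (Phi : {set 'I_k} -> V) :
  \sum_(js : n.-tuple 'I_k | sorted ltn (map val js)) Phi [set j in js]
    = \sum_(A : {set 'I_k} | #|A| == n) Phi A.
Proof.
pose S := [set js : n.-tuple 'I_k | sorted ltn (map val js)].
pose h (js : n.-tuple 'I_k) := [set j in js].
have SU (js : n.-tuple 'I_k) : js \in S -> uniq js.
  by rewrite inE => /(sorted_uniq ltn_trans ltnn); apply: map_uniq.
have hS : h @: S = [set A : {set 'I_k} | #|A| == n].
  apply/setP => A; rewrite inE; apply/imsetP/eqP => [[js jsS ->]|An].
    by rewrite cardsE (card_uniqP (SU _ jsS)) size_tuple.
  have sz : size (enum A) == n by rewrite -cardE An.
  exists (Tuple sz); last by apply/setP => j; rewrite inE mem_enum.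
  rewrite inE /= sorted_map /enum_mem; apply: sorted_filter.
    by move=> ? ? ?; apply: ltn_trans.
  by rewrite -enumT -sorted_map val_enum_ord iota_ltn_sorted.
transitivity (\sum_(A in h @: S) Phi A).
  rewrite big_imset /=; first by apply: eq_bigl => js; rewrite inE.
  move=> s1 s2 s1S s2S /setP hE; apply/val_inj/(inj_map val_inj).
  move: s1S s2S; rewrite !inE => s1S s2S.
  apply: (irr_sorted_eq ltn_trans ltnn) => // j.
  by apply/mapP/mapP => -[i is_ ->]; exists i => //; have := hE i; rewrite !inE is_.
by rewrite hS; apply: eq_bigl => A; rewrite inE.
Qed.

(** Both sides are the elementary symmetric function of degree [n] in [1, q, ..., q^(b-a-1)]: each
    term of the expanded product selects a subset of the interval. *)
Lemma sum_interval_subsets (F : fieldType) (q : F) k a b n : (b <= k)%N ->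
  \sum_(A : {set 'I_k} | #|A| == n)
      (if A \subset [set j : 'I_k | (a <= j < b)%N]
       then q ^+ (\sum_(j in A) (j - a)) else 0)
    = (\prod_(m < b - a) (1 + (q ^+ m)%:P * 'X) : {poly F})`_n.
Proof.
move=> bk; set B := [set j : 'I_k | _].
(* Factors [1] are added outside the interval so that the product runs over all of ['I_k] and
   expands over all subsets. *)
have -> : \prod_(m < b - a) (1 + (q ^+ m)%:P * 'X)
    = \prod_(j < k) ((if j \in B then (q ^+ (j - a))%:P * 'X else 0) + 1).
  transitivity (\prod_(m < b - a) (1 + (q ^+ (a + m - a))%:P * 'X)).
    by apply: eq_bigr => m _; rewrite addKn.
  rewrite -(big_ord_interval _ _ (fun j => 1 + (q ^+ (j - a))%:P * 'X) bk).
  rewrite big_mkcond; apply: eq_bigr => j _; rewrite inE.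
  by case: ifP; rewrite ?add0r // addrC.
rewrite bigA_distr coef_sum [LHS]big_mkcond; apply: eq_bigr => A _.
rewrite -big_mkcond /=; have [AB|/subsetPn[j jA jB]] := boolP (A \subset B); last first.
  by rewrite (bigD1 j) //= (negPf jB) mul0r coef0 if_same.
have -> : \prod_(j in A) (if j \in B then (q ^+ (j - a))%:P * 'X else 0)
    = \prod_(j in A) ((q ^+ (j - a))%:P * 'X).
  by apply: eq_bigr => j jA; rewrite (subsetP AB _ jA).
rewrite big_split /= -rmorph_prod prodrXr prodr_const coefCM coefXn eq_sym.
by case: eqP; rewrite ?mulr1 ?mulr0.
Qed.
End SortedTuples.

(** * Clusters as blocks of equal coordinates *)

Section Clusters.
Set Implicit Arguments.
Unset Strict Implicit.
Variables (k : nat) (F : fieldType).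
Implicit Types (x : 'rV[int]_k) (c : seq nat) (A B : {set 'I_k}).

Lemma foldr_shift_op (js : seq 'I_k) (f : 'rV[int]_k -> F) x :
  foldr (@shift_op k F) f js x = f (x - \sum_(j <- js) basis_vec k j).
Proof.
elim: js x => [|j js IHjs] x /=; first by rewrite big_nil subr0.
by rewrite /shift_op IHjs big_cons opprD addrA.
Qed.

Lemma sub_basis_vecE x A (l : 'I_k) :
  (x - \sum_(j in A) basis_vec k j) 0 l = x 0 l - (l \in A)%:R.
Proof.
rewrite !mxE summxE; congr (_ - _).
under eq_bigr do rewrite mxE.
have [lA|lA] := boolP (l \in A).
  rewrite (bigD1 l) //= eqxx big1 ?addr0 // => j /andP[_ jl].
  by rewrite eq_sym (inj_eq val_inj) (negPf jl).
rewrite big1 // => j jA; rewrite (inj_eq val_inj).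
by case: eqP => // lj; rewrite lj jA in lA.
Qed.

(* The coordinates of both points form the same multiset. *)
Lemma W_invariant_sub_basis_vec (f : 'rV[int]_k -> F) x (xi : int) A A' B :
    W_invariant f -> (forall j, j \in B -> x 0 j = xi) ->
    A \subset B -> A' \subset B -> #|A| = #|A'| ->
  f (x - \sum_(j in A) basis_vec k j) = f (x - \sum_(j in A') basis_vec k j).
Proof.
move=> fW xB AB A'B AA'; pose z (C : {set 'I_k}) := x - \sum_(j in C) basis_vec k j.
(* The list depends on [C] only through [#|C|]: lowered coordinates, coordinates of [B] left in
   place, coordinates outside [B]. *)
have zE (C : {set 'I_k}) : C \subset B -> perm_eq [tuple z C 0 l | l < k]
    (nseq #|C| (xi - 1) ++ nseq (#|B| - #|C|) xi ++ [seq x 0 l | l <- enum (~: B)]).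
  move=> CB; have CBP := subsetP CB; rewrite -(cardsDS CB).
  have mapN (D : {set 'I_k}) v : (forall l, l \in D -> z C 0 l = v) ->
      [seq z C 0 l | l <- enum D] = nseq #|D| v.
    move=> zv; rewrite cardE -(size_map (z C 0)); apply/all_pred1P/allP => u.
    by case/mapP => l; rewrite mem_enum => /zv-> ->; apply/eqP.
  have /perm_trans-> // : perm_eq [tuple z C 0 l | l < k]
      (map (z C 0) (enum C ++ enum (B :\: C) ++ enum (~: B))).
    apply: perm_map; apply: uniq_perm; rewrite ?enum_uniq //.
      rewrite !cat_uniq !enum_uniq /= andbT; apply/andP; split.
        apply/hasPn => l; rewrite mem_cat !mem_enum !inE.
        by case: (boolP (l \in C)) => // /CBP ->.
      by apply/hasPn => l; rewrite !mem_enum !inE => /negPf->; rewrite andbF.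
    move=> l; rewrite !mem_cat !mem_enum !inE.
    by case: (l \in B); case: (l \in C).
  rewrite !map_cat (mapN C (xi - 1)) => [|l lC]; last first.
    by rewrite sub_basis_vecE lC xB ?CBP.
  rewrite (mapN (B :\: C) xi) => [|l]; last first.
    by rewrite inE sub_basis_vecE => /andP[/negPf-> lB]; rewrite subr0 xB.
  rewrite (_ : map (z C 0) (enum (~: B)) = map (x 0) (enum (~: B))) //.
  apply/eq_in_map => l; rewrite mem_enum inE => lB.
  by rewrite sub_basis_vecE (contraNF (@CBP l)) // subr0.
have /tuple_permP[w zw] : perm_eq [tuple z A 0 l | l < k] [tuple z A' 0 l | l < k].
  by rewrite (perm_trans (zE A AB)) // perm_sym AA' zE.
rewrite -[LHS]/(f (z A)) -[RHS](fW w); congr f; apply/rowP => l; rewrite [RHS]mxE.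
have := congr1 (fun s => nth 0 s l) zw.
by rewrite -!tnth_nth !tnth_mktuple.
Qed.

Definition block c i : {set 'I_k} :=
  [set j : 'I_k | (partial_sum c i <= j < partial_sum c i.+1)%N].

Lemma partial_sum_mono c i j : (i <= j)%N -> (partial_sum c i <= partial_sum c j)%N.
Proof.
move=> ij; rewrite -(subnKC ij); elim: (j - i)%N => [|d IHd]; first by rewrite addn0.
by rewrite addnS partial_sumS (leq_trans IHd) // leq_addr.
Qed.

Lemma block_inj c i i' (j : 'I_k) : j \in block c i -> j \in block c i' -> i = i'.
Proof.
rewrite !inE => /andP[ij ji] /andP[i'j ji'].
have [ii'|ii'|//] := ltngtP i i'; have := partial_sum_mono c ii'; lia.
Qed.

Variables (x : 'rV[int]_k) (c : seq nat).
Hypothesis xc : is_cluster_coord x c.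

Lemma sumn_cluster : sumn c = k.
Proof. by case/and4P: xc => _ /eqP. Qed.

Lemma partial_sum_le_dim i : (partial_sum c i <= k)%N.
Proof. by rewrite -sumn_cluster partial_sum_le. Qed.

Lemma cluster_size_le i : (nth 0%N c i <= k)%N.
Proof. by have := partial_sum_le_dim i.+1; rewrite partial_sumS; lia. Qed.

Lemma block_cover (j : 'I_k) : exists i : 'I_(size c), j \in block c i.
Proof.
suff: forall n, (j < partial_sum c n)%N ->
    exists2 i, (i < n)%N & j \in block c i.
  case/(_ (size c)) => [|i ic ji]; last by exists (Ordinal ic).
  by rewrite partial_sum_size // sumn_cluster.
elim=> [|n IHn] jn; first by rewrite /partial_sum take0 in jn.
have [/IHn[i ic ji]|nj] := ltnP j (partial_sum c n).
  by exists i => //; apply: ltnW.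
by exists n; rewrite // inE nj.
Qed.

Lemma block_eps i (j : 'I_k) : (i < size c)%N -> j \in block c i ->
  x 0 j = eps (partial_sum c i.+1).-1 x.
Proof.
case/and4P: xc => _ _ _ /forallP cc ic; rewrite inE => ji; rewrite -eps_ord.
by have /forallP/(_ j)/implyP/(_ ji)/eqP := cc (Ordinal ic).
Qed.

Lemma eps_block_decr i i' : (i < i')%N -> (i' < size c)%N ->
  eps (partial_sum c i'.+1).-1 x < eps (partial_sum c i.+1).-1 x.
Proof.
case/and4P: xc => _ _ /forallP cd _.
have lt1 m : (m.+1 < size c)%N ->
    eps (partial_sum c m.+2).-1 x < eps (partial_sum c m.+1).-1 x.
  by move=> mc; have /implyP := cd (Ordinal (ltnW mc)); apply.
elim: i' => // i' IHi'; rewrite ltnS leq_eqVlt => /predU1P[->|ii'] ic; first exact: lt1.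
by apply: lt_trans (lt1 _ ic) _; apply: IHi' => //; apply: ltnW.
Qed.

(** Coordinates are constant on a block and strictly decrease between blocks. This translates the
    conditions in [dplus], [dminus] and [delta_coord]. *)
Lemma block_eq i (j l : 'I_k) : (i < size c)%N -> j \in block c i ->
  (x 0 l == x 0 j) = (l \in block c i).
Proof.
move=> ic ji; apply/eqP/idP => [lj|li]; last by rewrite !(@block_eps i).
have [i' li'] := block_cover l.
rewrite (block_eps ic ji) (block_eps (ltn_ord i') li') in lj.
have [ii'|i'i|-> //] := ltngtP i i'.
  by have := eps_block_decr ii' (ltn_ord i'); rewrite lj ltxx.
by have := eps_block_decr i'i ic; rewrite lj ltxx.
Qed.

Lemma card_interval a b : (b <= k)%N -> #|[set j : 'I_k | (a <= j < b)%N]| = (b - a)%N.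
Proof.
move=> bk; rewrite -sum1_card; under eq_bigl do rewrite inE.
by rewrite (big_ord_interval _ _ (fun=> 1%N) bk) sum_nat_const card_ord muln1.
Qed.

Lemma card_block i : #|block c i| = nth 0%N c i.
Proof.
by rewrite card_interval ?partial_sum_le_dim // partial_sumS addKn.
Qed.

(** Only earlier indices of the same block are counted. Since [dplus] counts the later ones, the two
    add up to the block size minus one. *)
Lemma dminus_block i (j : 'I_k) : (i < size c)%N -> j \in block c i ->
  dminus j x = (j - partial_sum c i)%N.
Proof.
move=> ic ji; rewrite -(@card_interval _ j) ?(ltnW (ltn_ord j)) //.
apply: eq_card => l; rewrite !inE subr_eq0 (block_eq _ ic ji) inE.
by move: ji; rewrite inE; lia.
Qed.

Lemma dplus_block i (j : 'I_k) : (i < size c)%N -> j \in block c i ->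
  dplus j x = (partial_sum c i.+1 - j.+1)%N.
Proof.
move=> ic ji; rewrite -(@card_interval j.+1) ?partial_sum_le_dim //.
apply: eq_card => l; rewrite !inE subr_eq0 eq_sym (block_eq _ ic ji) inE.
by move: ji; rewrite inE; lia.
Qed.

Lemma sum_blocks (V : nmodType) (G : 'I_k -> V) :
  \sum_j G j = \sum_(i < size c) \sum_(j in block c i) G j.
Proof.
rewrite (exchange_big_dep xpredT) //=; apply: eq_bigr => j _.
have [i ji] := block_cover j; rewrite (big_pred1 i) // => i' /=.
by apply/idP/eqP => [ji'|->//]; apply/val_inj/(block_inj ji' ji).
Qed.

Lemma lower_vecE i r : (r < nth 0%N c i)%N ->
  lower_vec x c i r = x - \sum_(j in [set j : 'I_k |
    (partial_sum c i.+1 - r.+1 <= j < partial_sum c i.+1)%N]) basis_vec k j.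
Proof.
move=> rc; rewrite /lower_vec; congr (x - _).
under [RHS]eq_bigl do rewrite inE.
rewrite (big_ord_interval _ _ (basis_vec k) (partial_sum_le_dim _)).
have -> : (partial_sum c i.+1 - (partial_sum c i.+1 - r.+1) = r.+1)%N.
  by rewrite subKn // partial_sumS; lia.
rewrite (reindex_inj rev_ord_inj) /=; apply: eq_bigr => p _.
by congr basis_vec; have := ltn_ord p; rewrite partial_sumS; lia.
Qed.

End Clusters.

(** * The Hamiltonian as a sum over clusters *)

Section HamiltonianOnClusters.
Set Implicit Arguments.
Unset Strict Implicit.
Variables (k : nat) (F : fieldType) (x : 'rV[int]_k) (c : seq nat).
Hypothesis xc : is_cluster_coord x c.

Lemma sum_dplus (G : nat -> F) :
  \sum_j G (dplus j x) = \sum_(i < size c) \sum_(m < nth 0%N c i) G m.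
Proof.
rewrite (sum_blocks xc); apply: eq_bigr => i _.
under eq_bigr => j ji do rewrite (dplus_block xc (ltn_ord i) ji).
under eq_bigl do rewrite inE.
rewrite (big_ord_interval _ _ (fun j => G (partial_sum c i.+1 - j.+1)%N)); last first.
  exact: partial_sum_le_dim xc _.
rewrite partial_sumS addKn (reindex_inj rev_ord_inj) /=; apply: eq_bigr => m _.
by congr G; have := ltn_ord m; lia.
Qed.

(** A tuple survives [delta_coord] only inside one block. There the denominator depends on the block
    size alone, and invariance of [f] moves the hop to the last [r.+1] coordinates, so only the
    powers of [q] remain to be summed over subsets. *)
Lemma sum_hops (q s : F) r (f : 'rV[int]_k -> F) : W_invariant f ->
  \sum_(js : r.+1.-tuple 'I_k | sorted ltn (map val js))
      q ^+ (\sum_(p < r.+1) dminus (tnth js p) x) * delta_coord F js x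
      / (\prod_(p < r.+1)
           (1 + s * qint q (dplus (thead js) x + dminus (thead js) x - p)))
      * foldr (@shift_op k F) f js x
    = \sum_(i < size c)
        (\prod_(m < nth 0%N c i) (1 + (q ^+ m)%:P * 'X) : {poly F})`_r.+1
        / (\prod_(p < r.+1) (1 + s * qint q (nth 0%N c i - 1 - p)))
        * f (lower_vec x c i r).
Proof.
move=> fW.
pose K i := (\prod_(p < r.+1) (1 + s * qint q (nth 0%N c i - 1 - p)))^-1
  * f (lower_vec x c i r).
(* A nonempty [A] lies in at most one block, so at most one term is nonzero; summing over all blocks
   allows the sums to be exchanged. *)
pose Phi (A : {set 'I_k}) := \sum_(i < size c)
  (if A \subset block k c i then q ^+ (\sum_(j in A) (j - partial_sum c i)) else 0)
  * K i.
transitivity (\sum_(js : r.+1.-tuple 'I_k | sorted ltn (map val js))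
    Phi [set j in js]); last first.
  rewrite sum_sorted_tuples exchange_big /=; apply: eq_bigr => i _.
  rewrite -mulr_suml sum_interval_subsets ?(partial_sum_le_dim xc) //.
  by rewrite partial_sumS addKn mulrA.
apply: eq_bigr => js /(sorted_uniq ltn_trans ltnn)/map_uniq js_uniq.
set A := [set j in js]; have [i ti] := block_cover xc (thead js).
have tA : thead js \in A by rewrite inE mem_tnth.
have sumA (V : nmodType) (G : 'I_k -> V) : \sum_(j <- js) G j = \sum_(j in A) G j.
  by rewrite big_uniq //; apply: eq_bigl => j; rewrite inE.
have -> : delta_coord F js x = (A \subset block k c i)%:R.
  congr (nat_of_bool _)%:R; apply/forallP/subsetP => [dA j jA|AB j].
    rewrite -(block_eq xc _ (ltn_ord i) ti); have /forallP/(_ (thead js))/implyP := dA j.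
    by rewrite !inE in tA jA; apply; rewrite jA.
  apply/forallP => l; apply/implyP => /andP[jA lA].
  by rewrite (block_eq xc _ (ltn_ord i) (j := l)) AB // inE.
rewrite /Phi (bigD1 i) //= [X in _ + X]big1 ?addr0 => [|i' i'i]; last first.
  case: ifP => [/subsetP/(_ _ tA) ti'|]; last by rewrite mul0r.
  by case/eqP: i'i; apply/val_inj/(block_inj ti' ti).
case: ifP => [AB|_]; last by rewrite mulr0 !mul0r.
have ABP := subsetP AB.
have cA : #|A| = r.+1 by rewrite cardsE (card_uniqP js_uniq) size_tuple.
have rc : (r < nth 0%N c i)%N by rewrite -(card_block xc) -cA subset_leq_card.
have ck := partial_sum_le_dim xc i.+1.
rewrite mulr1 /K mulrA; congr (_ / _ * _).
- congr (_ ^+ _); rewrite -(big_tuple _ _ _ predT (fun j => dminus j x)).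
  rewrite big_uniq //; apply: eq_big => [j|j jA]; first by rewrite inE.
  by rewrite (dminus_block xc (ltn_ord i)) // ABP // inE.
- apply: eq_bigr => p _; congr (1 + s * qint q (_ - _)).
  rewrite (dminus_block xc (ltn_ord i) ti) (dplus_block xc (ltn_ord i) ti).
  by move: ti; rewrite inE partial_sumS; lia.
rewrite foldr_shift_op sumA (lower_vecE xc rc).
apply: (W_invariant_sub_basis_vec fW (B := block k c i)
  (xi := eps (partial_sum c i.+1).-1 x)) => //.
- by move=> j; apply: (block_eps xc (ltn_ord i)).
- by apply/subsetP => j; rewrite !inE partial_sumS; lia.
- by rewrite cA card_interval // subKn // partial_sumS; lia.
Qed.

(** The Gaussian binomial absorbs the q-factorial and the negative power of [q], leaving a falling
    product of q-integers over [[r+1]], as in [cluster_op]. *)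
Lemma hamiltonian_clusters (al be ga de : F) (f : 'rV[int]_k -> F)
    (q := q_param al be ga de) (s := be * ga) :
    q != 0 -> (forall r, (1 <= r <= k)%N -> qint q r != 0) -> W_invariant f ->
  hamiltonian al be ga de f x
    = \sum_(i < size c)
        (- (al * ga) * (\sum_(m < nth 0%N c i) qint q m / (1 + s * qint q m)) * f x
         + \sum_(r < nth 0%N c i) (- (be * de)) ^+ r / qint q r.+1
             * (\prod_(p < r.+1) (qint q (nth 0%N c i - p)
                                  / (1 + s * qint q (nth 0%N c i - 1 - p))))
             * f (lower_vec x c i r)).
Proof.
move=> q0 qn0 fW; rewrite /hamiltonian -/q -/s big_split /=; congr (_ + _).
  by rewrite (sum_dplus (fun m => qint q m / (1 + s * qint q m))) mulr_sumr mulr_suml.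
under eq_bigr do rewrite sum_hops // mulr_sumr.
rewrite exchange_big /=; apply: eq_bigr => i _; set n := nth 0%N c i.
have nk : (n <= k)%N := cluster_size_le xc i.
(* The hop sum of [hamiltonian] runs up to [k]; its terms with [n <= r] vanish because their product
   contains [[0]]. *)
rewrite (big_ord_widen k (fun r => (- (be * de)) ^+ r / qint q r.+1
  * (\prod_(p < r.+1) (qint q (n - p) / (1 + s * qint q (n - 1 - p))))
  * f (lower_vec x c i r)) nk) [RHS]big_mkcond; apply: eq_bigr => r _.
have r0 : qint q r.+1 != 0 by apply: qn0; have := ltn_ord r; lia.
have := qbinomial_coef q n r.+1; rewrite qfactS mulrA.
rewrite [(r.+1 * _)%N]/= => /(canRL (mulfK r0)).
set e := _`_r.+1 => qb; rewrite prodf_div.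
set W := \prod_(p < r.+1) (1 + _); set fx := f _.
transitivity ((- (be * de)) ^+ r * (e * qfact q r) * q ^- ((r.+1 * r) %/ 2) / W * fx).
  ring.
rewrite qb; case: ltnP => [rn|nr]; last by rewrite qint_prod_small // !(mulr0, mul0r).
have : q ^+ ((r.+1 * r) %/ 2) != 0 by rewrite expf_neq0.
move: W^-1 (q ^+ _) => W' Q Q0; field.
by rewrite r0.
Qed.

End HamiltonianOnClusters.

(** * Comparison with the cluster operator in the two cases *)

Section HamiltonianAsClusterOp.
Set Implicit Arguments.
Unset Strict Implicit.
Variables (k : nat) (F : fieldType) (al be ga de : F).
Let q := q_param al be ga de.
Let s := be * ga.
Hypothesis q0 : q != 0.
Hypothesis qn0 : forall r, (1 <= r <= k)%N -> qint q r != 0.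
Hypothesis sn0 : forall n, (0 < n)%N -> 1 + s * qint q n != 0.

Lemma one_add_qint_neq0 n : 1 + s * qint q n != 0.
Proof. by case: n => [|n]; [rewrite qint0 mulr0 addr0 oner_neq0|apply: sn0]. Qed.

(** Reduces both cases to scalar identities: one for the hop weights, one for the diagonal at each
    position [m] of a cluster. The [+ 1] in the latter accounts for the subtracted [k]. *)
Lemma hamiltonian_cluster_op (s' t : F) (f : 'rV[int]_k -> F) :
    (forall r, (0 < r <= k)%N -> qint t r != 0) ->
    (forall m, (m < k)%N -> 1 + s' * qint t m != 0) ->
    (forall n r, (n <= k)%N -> (r < n)%N ->
      (- (be * de)) ^+ r / qint q r.+1
        * \prod_(p < r.+1) (qint q (n - p) / (1 + s * qint q (n - 1 - p)))
      = cluster_coef s' t n r) ->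
    (forall m, al * ga * (qint q m / (1 + s * qint q m)) + 1
      = t ^+ m / (1 + s' * qint t m)) ->
    W_invariant f ->
  restr (fun x => hamiltonian al be ga de f x - k%:R * f x)
    =1 cluster_op s' t (restr f).
Proof.
move=> t0 s0 hop diag fW y; rewrite /cluster_op /restr /=.
have xc : is_cluster_coord (val y) (cluster_coord y) := xchooseP _.
(* The subtracted [k] is written as the sum of the cluster sizes and shared out among the
   clusters. *)
rewrite (hamiltonian_clusters xc) // -/q -/s -[k in k%:R](sumn_cluster xc) sumnE.
set c := cluster_coord y.
rewrite (big_nth 0%N) big_mkord natr_sum mulr_suml -sumrB.
apply: eq_bigr => i _; rewrite -/c; set n := nth 0%N c i.
have nk : (n <= k)%N := cluster_size_le xc i.
transitivity (\sum_(r < n) cluster_coef s' t n r * (f (lower_vec (val y) c i r) - f (val y)));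
  last by [].
under [RHS]eq_bigr do rewrite mulrBr.
rewrite sumrB -mulr_suml sum_cluster_coef; first last.
- by move=> m mn; apply: s0; apply: leq_trans mn nk.
- by move=> r /andP[r1 rn]; rewrite t0 // r1 (leq_trans rn).
rewrite [X in _ + X - _](eq_bigr (fun r : 'I_n =>
  cluster_coef s' t n r * f (lower_vec (val y) c i r))); last first.
  by move=> r _; rewrite hop.
have <- : al * ga * (\sum_(m < n) qint q m / (1 + s * qint q m)) + n%:R
    = \sum_(m < n) t ^+ m / (1 + s' * qint t m).
  under [RHS]eq_bigr => m _ do rewrite -diag.
  by rewrite big_split /= -mulr_sumr sumr_const card_ord.
ring.
Qed.

(** Here [- (be * de) = s], so the hop weights agree at once; [al * ga = q - 1 - s] makes the
    diagonal term [(1 + (q - 1)[m]) / (1 + s[m])], whose numerator is [q^m]. *)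
Lemma hamiltonian_gade (f : 'rV[int]_k -> F) : ga + de = 0 -> W_invariant f ->
  restr (fun x => hamiltonian al be ga de f x - k%:R * f x)
    =1 cluster_op s q (restr f).
Proof.
move=> /eqP; rewrite addrC addr_eq0 => /eqP deE fW.
apply: hamiltonian_cluster_op => //.
- by move=> m _; apply: one_add_qint_neq0.
- by move=> n r _ _; rewrite deE mulrN opprK.
move=> m; have w0 := one_add_qint_neq0 m.
have -> : al * ga = q - 1 - s by rewrite /q /s /q_param deE; ring.
by rewrite expr_qint; field.
Qed.

(** Here [- (be * de) = al * de], and [al * ga = - s] makes the diagonal term [1 / (1 + s[m])]. The
    powers of [q] produced by inverting the base cancel in every weight. *)
Lemma hamiltonian_albe (f : 'rV[int]_k -> F) : al + be = 0 -> W_invariant f ->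
  restr (fun x => hamiltonian al be ga de f x - k%:R * f x)
    =1 cluster_op (q^-1 * (al * de)) q^-1 (restr f).
Proof.
move=> /eqP; rewrite addrC addr_eq0 => /eqP beE fW.
have sE : s = q - 1 + al * de by rewrite /q /s /q_param beE; ring.
have Q0 n : q ^+ n != 0 by rewrite expf_neq0.
(* This rests on [1 + s[m] = q^m + al * de * [m]]; [m = 0] is separate because [qintV] concerns
   successors. *)
have wE m : 1 + q^-1 * (al * de) * qint q^-1 m = q ^- m * (1 + s * qint q m).
  case: m => [|m]; first by rewrite !qint0 !mulr0 !addr0 expr0 invr1 mulr1.
  rewrite qintV // sE.
  have -> : 1 + (q - 1 + al * de) * qint q m.+1 = q ^+ m.+1 + al * de * qint q m.+1.
    by rewrite expr_qint; ring.
  by rewrite exprS; field; rewrite q0 Q0.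
apply: hamiltonian_cluster_op => //.
- by case=> // r rk; rewrite qintV // mulf_neq0 ?invr_neq0 ?qn0.
- by move=> m _; rewrite wE mulf_neq0 ?invr_neq0 ?one_add_qint_neq0.
- move=> n r nk rn; have b0 : qint q r.+1 != 0 by apply: qn0; lia.
  rewrite /cluster_coef beE mulNr opprK; congr (_ * _).
    by rewrite qintV // [(q^-1 * _) ^+ r]exprMn exprVn; field; rewrite Q0 b0.
  apply: eq_bigr => p _; rewrite wE; have := ltn_ord p => pr.
  (* Numerator and denominator then carry the same power [q^-(n-1-p)]. *)
  have -> : (n - p = (n - 1 - p).+1)%N by lia.
  have w0 := one_add_qint_neq0 (n - 1 - p).
  by rewrite qintV //; field; rewrite Q0 w0.
move=> m; rewrite wE exprVn; have w0 := one_add_qint_neq0 m.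
have -> : al * ga = - s by rewrite /s beE; ring.
by field; rewrite Q0 w0.
Qed.

End HamiltonianAsClusterOp.

Theorem proposition4p3 (R : realType) (k : nat) (al be ga de : R[i])
    (q := q_param al be ga de) :
  (2 <= k)%N ->
  q != 0 ->
  (forall r : nat, (1 <= r <= k)%N -> qint q r != 0) ->
  (forall n : nat, (0 < n)%N -> 1 + be * ga * qint q n != 0) ->
  (al + be) * (ga + de) = 0 ->
  (al + be = 0 ->
     forall f : 'rV[int]_k -> R[i], W_invariant f ->
       restr (fun x => hamiltonian al be ga de f x - k%:R * f x)
         =1 cluster_op (q^-1 * (al * de)) q^-1 (restr f))
  /\
  (ga + de = 0 ->
     forall f : 'rV[int]_k -> R[i], W_invariant f ->
       restr (fun x => hamiltonian al be ga de f x - k%:R * f x)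
         =1 cluster_op (be * ga) q (restr f)).
Proof.
move=> _ q0 qn0 sn0 _; split=> [albe|gade] f fW.
  exact: hamiltonian_albe.
exact: hamiltonian_gade.
Qed.
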